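(* Let $\theta:\mathbb{R}\to(-\infty,1)$ be of class $C^2$ with $\theta(0)=0$, $\lim_{t\to+\infty}\theta(t)=1$, $\theta'>0$ and $\theta''\leq 0$ on $\mathbb{R}$. Let $\psi=1-\theta$ and suppose that $V:=\big(-\psi'\circ\psi^{-1}\big)\cdot\psi^{-1}$ is locally sub-additive at $0^+$. Let $F:\mathbb{R}^n\to\mathbb{R}^n$ be a continuous $(P_0)$-function, and assume that the set $$\mathcal{Z}:=\{x\in\mathbb{R}^n:\ x\geq 0,\ F(x)\geq 0,\ x^{\top}F(x)=0\}$$ is nonempty and compact. For $r>0$ let $H_r(x):=\big(G_r(x_i,F_i(x))\big)_{i=1}^n$, $x\in\mathbb{R}^n$. Then: (i) there exists $\hat r>0$ such that for every $0<r<\hat r$ the equation $H_r(x)=0$ has a unique solution $x^{(r)}\in\mathbb{R}^n$, and the mapping $r\mapsto x^{(r)}$ is continuous on $(0,\hat r)$; (ii) $\displaystyle\lim_{r\to 0^+}\operatorname{dist}(x^{(r)},\mathcal{Z})=0$.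
   Context: Vector inequalities are componentwise, and $\operatorname{dist}(x,\mathcal{Z})=\inf_{z\in\mathcal{Z}}\|x-z\|$ with $\|\cdot\|$ the Euclidean norm. A function $F:\mathbb{R}^n\to\mathbb{R}^n$ is a $(P_0)$-function if for all $x\neq y$ in $\mathbb{R}^n$, $\max_{i:\,x_i\neq y_i}(x-y)_i\,(F_i(x)-F_i(y))\geq 0$. Under the hypotheses on $\theta$, $\psi=1-\theta$ is a decreasing bijection from $\mathbb{R}$ onto $(0,+\infty)$, with inverse $\psi^{-1}:(0,+\infty)\to\mathbb{R}$. The function $V:(0,+\infty)\to\mathbb{R}$ is $V(\alpha)=-\psi'(\psi^{-1}(\alpha))\,\psi^{-1}(\alpha)$. It is called locally sub-additive at $0^+$ if there exists $\eta>0$ such that $V(\alpha+\beta)\leq V(\alpha)+V(\beta)$ for all $\alpha,\beta>0$ with $\alpha+\beta<\eta$. For $r>0$ and $s,t\in\mathbb{R}$, $$G_r(s,t):=r\,\psi^{-1}\!\left[\psi\!\left(\tfrac{s}{r}\right)+\psi\!\left(\tfrac{t}{r}\right)\right].$$ *)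

(* Defs.v *)
From mathcomp Require Import all_boot all_order all_algebra.
From mathcomp Require Import all_classical all_reals all_analysis.

Set Implicit Arguments.
Unset Strict Implicit.
Unset Printing Implicit Defensive.

Import Order.TTheory GRing.Theory Num.Theory.
Import numFieldNormedType.Exports.

Local Open Scope classical_set_scope.
Local Open Scope ring_scope.

(* The library norm on matrices is the sup norm, hence these definitions. *)
Definition eucl_norm (R : realType) (n : nat) (x : 'rV[R]_n) : R :=
  Num.sqrt (\sum_(i < n) x ord0 i ^+ 2).

Definition eucl_dist (R : realType) (n : nat) (x : 'rV[R]_n)
    (Z : set 'rV[R]_n) : R :=
  inf [set eucl_norm (x - z) | z in Z].

(* The maximum is taken in \bar R, so that -oo is its neutral element; for
   x <> y the index set is nonempty and the maximum is finite. *)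
Definition P0_function (R : realType) (n : nat)
    (F : 'rV[R]_n -> 'rV[R]_n) : Prop :=
  forall x y : 'rV[R]_n, x <> y ->
    (0 <= \big[maxe/-oo]_(i < n | x ord0 i != y ord0 i)
            ((x - y) ord0 i * (F x ord0 i - F y ord0 i))%:E)%E.

Definition C2 (R : realType) (f : R -> R) : Prop :=
  [/\ forall t, derivable f t 1,
      forall t, derivable (f^`()%classic) t 1 &
      continuous (f^`()^`()%classic)].

Definition psi (R : realType) (theta : R -> R) : R -> R :=
  fun t => 1 - theta t.

(* The junk value 0 is only taken outside the range of psi. *)
Definition psi_inv (R : realType) (theta : R -> R) : R -> R :=
  'pinv_(fun=> 0) setT (psi theta).

Definition V (R : realType) (theta : R -> R) (a : R) : R :=
  - (psi theta)^`()%classic (psi_inv theta a) * psi_inv theta a.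

Definition locally_subadditive_at0 (R : realType) (W : R -> R) : Prop :=
  exists2 eta : R, 0 < eta &
    forall a b : R, 0 < a -> 0 < b -> a + b < eta -> W (a + b) <= W a + W b.

Definition G (R : realType) (theta : R -> R) (r s t : R) : R :=
  r * psi_inv theta (psi theta (s / r) + psi theta (t / r)).

Definition H (R : realType) (n : nat) (theta : R -> R)
    (F : 'rV[R]_n -> 'rV[R]_n) (r : R) (x : 'rV[R]_n) : 'rV[R]_n :=
  \row_(i < n) G theta r (x ord0 i) (F x ord0 i).

Definition NCP_solutions (R : realType) (n : nat)
    (F : 'rV[R]_n -> 'rV[R]_n) : set 'rV[R]_n :=
  [set x : 'rV[R]_n | [/\ forall i, 0 <= x ord0 i,
               forall i, 0 <= F x ord0 i &
               \sum_(i < n) x ord0 i * F x ord0 i = 0]].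

(* Main.v *)
(* [H_r x = 0] says [theta (x_i / r) + theta (F_i x / r) = 1] for all [i], whose
   left-hand side is increasing in both [x_i] and [F_i x]. More generally,
   consider systems [E_i (x_i, F_i x) = 0] with [E_i] increasing, strictly in
   its first argument, and of the right sign on the faces of a box [0, b]^n. The
   P0-property gives uniqueness, hence continuous dependence on parameters, and
   then existence follows from the intermediate value theorem by freezing one
   coordinate at a time; no degree theory is needed. Complementarity on the box
   is a limit of such systems in two ways. Tikhonov regularization centred at a
   moving point shows that no solution is separated from the others, so that, if
   the solution set is compact and [b] is large, the box adds no solution. The
   limit [r -> 0] of the system of [H_r], cut off at [b], then shows that its
   solutions approach the solution set; so they stay off the face [b] and solve
   [H_r x = 0]. *)
Require Import Defs.
From mathcomp Require Import all_boot all_order all_algebra.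
From mathcomp Require Import all_classical all_reals all_analysis.
From mathcomp Require Import lra.

Set Implicit Arguments.
Unset Strict Implicit.
Unset Printing Implicit Defensive.

Import Order.TTheory GRing.Theory Num.Theory.
Import numFieldNormedType.Exports.

Local Open Scope classical_set_scope.
Local Open Scope ring_scope.

(** * Continuity, the P0-property and the Euclidean distance *)

Lemma continuous_pair_for (T U V : topologicalType) (f : T -> U) (g : T -> V)
    (x : T) :
  {for x, continuous f} -> {for x, continuous g} ->
  {for x, continuous (fun y => (f y, g y))}.
Proof. exact: cvg_pair. Qed.

Lemma continuous_maxr (R : realType) (T : topologicalType) (f g : T -> R)
    (x : T) :
  {for x, continuous f} -> {for x, continuous g} ->
  {for x, continuous (fun y => Num.max (f y) (g y))}.
Proof. exact: continuous_max. Qed.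

Lemma continuous_minr (R : realType) (T : topologicalType) (f g : T -> R)
    (x : T) :
  {for x, continuous f} -> {for x, continuous g} ->
  {for x, continuous (fun y => Num.min (f y) (g y))}.
Proof. exact: continuous_min. Qed.

Lemma derivable_continuous (R : realType) (f : R -> R) :
  (forall t, derivable f t 1) -> continuous f.
Proof.
by move=> df t; apply/differentiable_continuous/derivable1_diffP.
Qed.

Lemma IVT_le (R : realType) (f : R -> R) (a b v : R) :
  a <= b -> continuous f -> f a <= v -> v <= f b ->
  exists2 c, a <= c <= b & f c = v.
Proof.
move=> ab fc fav vfb.
have [|c] := @IVT R f a b v ab (continuous_subspaceT fc).
  by rewrite ge_min fav le_max vfb orbT.
by rewrite in_itv /=; exists c.
Qed.

Lemma coord_le_mxnorm (R : realType) (n : nat) (x : 'rV[R]_n) (i : 'I_n) :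
  `|x ord0 i| <= `|x|.
Proof.
rewrite [leRHS]/Num.norm /= mx_normrE.
by apply/bigmax_geP; right => /=; exists (ord0, i).
Qed.

(** If all products were negative, so would be their maximum: the neutral element [-oo] is negative,
    and [max] preserves negativity. *)
Lemma P0_index (R : realType) (n : nat) (F : 'rV[R]_n -> 'rV[R]_n)
    (x y : 'rV[R]_n) :
  P0_function F -> x <> y ->
  exists2 i, x ord0 i != y ord0 i &
    0 <= (x ord0 i - y ord0 i) * (F x ord0 i - F y ord0 i).
Proof.
move=> P0 xy; apply: contrapT => noi.
have := P0 x y xy; rewrite leNgt => /negP; apply.
elim/big_ind: _ => [|u v u0 v0|i xyi]; first exact: ltNyr.
  by rewrite gt_max u0 v0.
rewrite lte_fin ltNge; apply/negP => h; apply: noi; exists i => //.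
by move: h; rewrite !mxE.
Qed.

Lemma eucl_norm_continuous (R : realType) (n : nat) :
  continuous (@eucl_norm R n).
Proof.
move=> x; apply: (@continuous_comp _ _ _
  (fun x : 'rV[R]_n => \sum_(i < n) x ord0 i ^+ 2) Num.sqrt).
  move: x; apply: continuous_big => [|i _ x]; first exact: add_continuous.
  apply: (@continuous_comp _ _ _ (fun x : 'rV[R]_n => x ord0 i)
    (fun s => s ^+ 2)).
    exact: coord_continuous.
  exact: exprn_continuous.
exact: sqrt_continuous.
Qed.

Lemma open_eucl_nbhd (R : realType) (n : nat) (Z : set 'rV[R]_n) (d : R) :
  open [set x | exists2 z, Z z & eucl_norm (x - z) < d].
Proof.
rewrite (_ : mkset _ =
  \bigcup_(z in Z) [set x | eucl_norm (x - z) < d]); last first.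
  by apply/seteqP; split => x [z Zz xz]; exists z.
apply: bigcup_open => z _.
apply: (@open_comp _ _ (fun x : 'rV[R]_n => eucl_norm (x - z))
  [set s : R | s < d]).
  move=> x _; apply: (@continuous_comp _ _ _ (fun x : 'rV[R]_n => x - z)
    (@eucl_norm R n)).
    by apply: (@continuousB R 'rV[R]_n 'rV[R]_n id (fun=> z));
      [exact: cvg_id|exact: cst_continuous].
  exact: eucl_norm_continuous.
exact: open_lt.
Qed.

Lemma eucl_norm0 (R : realType) (n : nat) : eucl_norm (0 : 'rV[R]_n) = 0.
Proof.
rewrite /eucl_norm big1 ?sqrtr0 // => i _.
by rewrite mxE expr0n.
Qed.

Lemma eucl_dist_lt (R : realType) (n : nat) (Z : set 'rV[R]_n) (x z : 'rV[R]_n)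
    (d : R) : Z z -> eucl_norm (x - z) < d -> 0 <= eucl_dist x Z < d.
Proof.
move=> Zz xz.
have lb : lbound [set eucl_norm (x - z) | z in Z] 0.
  by move=> _ [y _ <-]; exact: sqrtr_ge0.
apply/andP; split.
  by apply: lb_le_inf => //; exists (eucl_norm (x - z)); exists z.
by apply: le_lt_trans xz; apply: ge_inf; [exists 0|exists z].
Qed.

(** * Increasing systems on a box *)

Section box_problem.
Variables (R : realType) (n : nat) (F : 'rV[R]_n -> 'rV[R]_n).

(** Monotonicity in the second argument is only weak, so that equations not involving [F]
    qualify. *)
Definition strict_mono (e : R -> R -> R) :=
  forall s s' t t', s < s' -> t <= t' -> e s t < e s' t'.

(** Asking for the face signs at every [t] makes them independent of [F]. *)
Definition barrier (b : R) (e : R -> R -> R) :=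
  [/\ strict_mono e, continuous (fun p : R * R => e p.1 p.2),
      forall t, e 0 t <= 0 & forall t, 0 <= e b t].

Definition is_zero (E : 'I_n -> R -> R -> R) (x : 'rV[R]_n) :=
  forall i, E i (x ord0 i) (F x ord0 i) = 0.

Definition box (b : R) : set 'rV[R]_n :=
  [set x | forall i, 0 <= x ord0 i <= b].

Lemma compact_box b : compact (box b).
Proof.
apply: (@rV_compact R n (fun=> [set s : R | 0 <= s <= b])) => _.
exact: (@segment_compact R 0 b).
Qed.

(** Outside [[0, b]], strict monotonicity pushes the value strictly past its sign on the nearer
    face. *)
Lemma zero_in_box b (E : 'I_n -> R -> R -> R) x :
  (forall i, barrier b (E i)) -> is_zero E x -> box b x.
Proof.
move=> Eb Ex i; have [Em _ E0 Eb0] := Eb i.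
rewrite !leNgt; apply/andP; split; apply/negP => h.
  by have := Em _ _ _ _ h (lexx (F x ord0 i)); rewrite Ex ltNge E0.
by have := Em _ _ _ _ h (lexx (F x ord0 i)); rewrite Ex ltNge Eb0.
Qed.

(** Where two zeros differ, the larger coordinate comes with the strictly smaller value of [F], so
    every product in the P0-property would be negative. *)
Lemma zero_unique (E : 'I_n -> R -> R -> R) x y : P0_function F ->
  (forall i, strict_mono (E i)) -> is_zero E x -> is_zero E y -> x = y.
Proof.
move=> P0 Em Ex Ey; apply: contrapT => /(P0_index P0)[i].
have key u v : is_zero E u -> is_zero E v -> u ord0 i < v ord0 i ->
    F v ord0 i < F u ord0 i.
  move=> Eu Ev uv; rewrite ltNge; apply/negP => h.
  by have := Em i _ _ _ _ uv h; rewrite Eu Ev ltxx.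
rewrite neq_lt => /orP[xy|xy].
  by have := key x y Ex Ey xy; nra.
by have := key y x Ey Ex xy; nra.
Qed.

Hypothesis F_cont : continuous F.

Lemma Fcoord_cont i : continuous (fun x => F x ord0 i).
Proof.
move=> x; apply: (@continuous_comp _ _ _ F (fun y : 'rV[R]_n => y ord0 i)).
  exact: F_cont.
exact: coord_continuous.
Qed.

(** By uniqueness, points of the box outside [U] are not zeros at [a]; compactness of the box makes
    this uniform for parameters near [a]. *)
Lemma zero_continuous (T : topologicalType) (E : T -> 'I_n -> R -> R -> R)
    (b : R) (x : T -> 'rV[R]_n) (a : T) :
  (\forall c \near a, box b (x c) /\ is_zero (E c) (x c)) ->
  (forall i p, {for (a, p), continuous
     (fun u : T * (R * R) => E u.1 i u.2.1 u.2.2)}) ->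
  (forall y, is_zero (E a) y -> y = x a) ->
  {for a, continuous x}.
Proof.
move=> xz Ec Euniq U Ua; rewrite /nbhs/=.
have /compact_near_coveringP/(_ T (nbhs a)
  (fun c y => is_zero (E c) y -> U y) _) cov := @compact_box b.
suff H : \forall c \near a, box b `<=` (fun y => is_zero (E c) y -> U y).
  near=> c; have [] : box b (x c) /\ is_zero (E c) (x c) by near: c.
  by apply: (near H c) => //; near: c.
apply: cov => y _; have [Ey|nEy] := pselect (is_zero (E a) y).
  exists (U, setT) => /=; first by rewrite (Euniq _ Ey); split=> //;
    exact: filterT.
  by move=> [y' c] [].
have [i Ei] : exists i, E a i (y ord0 i) (F y ord0 i) != 0.
  apply: contrapT => h; apply: nEy => i; apply/eqP/negPn/negP => hi.
  by apply: h; exists i.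
pose g (v : 'rV[R]_n * T) := E v.2 i (v.1 ord0 i) (F v.1 ord0 i).
have gc : {for (y, a), continuous g}.
  apply: (@continuous_comp _ _ _ (fun v : 'rV[R]_n * T =>
    (v.2, (v.1 ord0 i, F v.1 ord0 i))) _ (y, a) _ (Ec i _)).
  apply: continuous_pair_for; first exact: cvg_snd.
  apply: continuous_pair_for.
    apply: (@continuous_comp _ _ _ fst (fun z : 'rV[R]_n => z ord0 i)).
      exact: cvg_fst.
    exact: coord_continuous.
  apply: (@continuous_comp _ _ _ fst (fun z : 'rV[R]_n => F z ord0 i)).
    exact: cvg_fst.
  exact: Fcoord_cont.
have : nbhs (y, a) (g @^-1` [set z | z != 0]).
  by apply: gc; apply: open_nbhs_nbhs; split => //; exact: open_neq.
apply: filterS => -[y' c] /= + zc; rewrite /g/=.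
by move/eqP: (zc i) => ->.
Unshelve. all: by end_near. Qed.

End box_problem.

(** * Existence of zeros by freezing coordinates *)

Section existence.
Variables (R : realType) (n : nat) (F : 'rV[R]_n -> 'rV[R]_n).
Hypothesis F_cont : continuous F.
Hypothesis F_P0 : P0_function F.

Definition clamp (b w : R) : R := Num.max 0 (Num.min w b).

Lemma clampP b w : 0 <= b -> 0 <= clamp b w <= b.
Proof. by move=> b0; rewrite /clamp le_max lexx ge_max b0 ge_min lexx orbT. Qed.

Lemma continuous_clamp b : continuous (clamp b).
Proof.
move=> w; apply: (@continuous_maxr R R (fun=> 0) (fun y => Num.min y b)).
  exact: cst_continuous.
by apply: (@continuous_minr R R id (fun=> b));
  [exact: cvg_id|exact: cst_continuous].
Qed.

(* Induction on the number of coordinates in which [E] depends on its second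
   argument: freezing one more coordinate at [w] gives a solution that depends
   continuously on [w], and the frozen equation is recovered by the
   intermediate value theorem. *)
Lemma exists_zero_rec (b : R) (k : nat) (E : 'I_n -> R -> R -> R) :
  0 <= b -> (forall i, barrier b (E i)) ->
  (forall i : 'I_n, (k <= i)%N -> forall s t t', E i s t = E i s t') ->
  exists x, is_zero F E x.
Proof.
move=> b0; elim: k E => [|k IH] E Eb Ei.
  (* No equation involves [F] any more: the system splits into scalar equations on [[0, b]]. *)
  have /choice[f Ef] : forall i, exists s, E i s 0 = 0.
    move=> i; have [_ Ec E0 Eb0] := Eb i.
    have [|s _ Es] := @IVT_le R (fun s => E i s 0) 0 b 0 b0 _ (E0 _) (Eb0 _).
      move=> s; apply: (@continuous_comp _ _ _ (fun s : R => (s, 0 : R))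
        (fun p : R * R => E i p.1 p.2)); last exact: Ec.
      by apply: continuous_pair_for; [exact: cvg_id|exact: cst_continuous].
    by exists s.
  exists (\row_i f i) => i; rewrite mxE -(Ef i); exact: Ei.
(* For [n <= k] there is no coordinate [k] to freeze, and the condition for [k] is vacuous. *)
have [kn|nk] := ltnP k n; last first.
  apply: IH => // i ki; have := leq_trans (ltn_ord i) nk.
  by rewrite ltnNge ki.
pose i0 := Ordinal kn.
pose E' (w : R) (i : 'I_n) :=
  if i == i0 then fun s _ : R => s - clamp b w else E i.
have E'b w i : barrier b (E' w i).
  rewrite /E'; case: eqP => // _; have /andP[c0 cb] := clampP w b0.
  split => [s s' t t' ss' _|p|_|_]; [lra| |lra|lra].
  by apply: cvgB; [exact: cvg_fst|exact: cvg_cst].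
have /choice[x xz] : forall w, exists x, is_zero F (E' w) x.
  move=> w; apply: IH => // i ki s t t'; rewrite /E'; case: eqP => // ne.
  by apply: Ei; rewrite ltn_neqAle ki andbT; apply/eqP => h; apply/ne/val_inj.
have xc : continuous x.
  move=> w; apply: (@zero_continuous R n F F_cont _ E' b).
  - by near=> c; split; [exact: zero_in_box (E'b c) (xz c)|exact: xz].
  - move=> i p; rewrite /E'; case: eqP => _.
      apply: cvgB.
        by apply: (@continuous_comp _ _ _ snd fst);
          [exact: cvg_snd|exact: cvg_fst].
      apply: (@continuous_comp _ _ _ fst (clamp b)); first exact: cvg_fst.
      exact: continuous_clamp.
    have [_ Ec _ _] := Eb i.
    apply: (@continuous_comp _ _ _ snd (fun p : R * R => E i p.1 p.2)).
      exact: cvg_snd.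
    exact: Ec.
  - move=> y yz; apply: zero_unique yz (xz w) => // i.
    by have [] := E'b w i.
have xi0 w : x w ord0 i0 = clamp b w.
  by have /eqP := xz w i0; rewrite /E' eqxx subr_eq0 => /eqP.
have [Em Ec E0 Eb0] := Eb i0.
pose g w := E i0 (x w ord0 i0) (F (x w) ord0 i0).
have [|||w _ gw] := @IVT_le R g 0 b 0 b0.
- move=> w; apply: (@continuous_comp _ _ _ (fun w =>
    (x w ord0 i0, F (x w) ord0 i0)) (fun p : R * R => E i0 p.1 p.2)).
    apply: continuous_pair_for.
      apply: (@continuous_comp _ _ _ x (fun z : 'rV[R]_n => z ord0 i0)).
        exact: xc.
      exact: coord_continuous.
    apply: (@continuous_comp _ _ _ x (fun z : 'rV[R]_n => F z ord0 i0)).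
      exact: xc.
    exact: Fcoord_cont.
  exact: Ec.
- by rewrite /g xi0 /clamp min_l // maxxx.
- by rewrite /g xi0 /clamp minxx max_r.
exists (x w) => i; have := xz w i; rewrite /E'; case: eqP => // -> _.
exact: gw.
Unshelve. all: by end_near. Qed.

Lemma exists_zero (b : R) (E : 'I_n -> R -> R -> R) :
  0 <= b -> (forall i, barrier b (E i)) -> exists x, is_zero F E x.
Proof.
move=> b0 Eb; apply: (@exists_zero_rec b n) => // i.
by rewrite leqNgt ltn_ord.
Qed.

End existence.

(** * Complementarity on a box *)

Section box_complementarity.
Variables (R : realType) (n : nat) (F : 'rV[R]_n -> 'rV[R]_n).
Hypothesis F_cont : continuous F.

(** The term [s - b] supplies the sign on the face [s = b] and creates no zero below that face. *)
Definition cutoff (b : R) (e : R -> R -> R) (s t : R) : R :=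
  Num.max (e s t) (s - b).

Lemma barrier_cutoff (b : R) (e : R -> R -> R) : 0 <= b -> strict_mono e ->
  continuous (fun p : R * R => e p.1 p.2) -> (forall t, e 0 t <= 0) ->
  barrier b (cutoff b e).
Proof.
move=> b0 em ec e0; split => [s s' t t' ss' tt'|p|t|t]; rewrite /cutoff.
- by rewrite gt_max !lt_max em //= ltrD2r ss' orbT.
- apply: (@continuous_maxr R _ (fun p => e p.1 p.2) (fun p => p.1 - b)).
    exact: ec.
  by apply: cvgB; [exact: cvg_fst|exact: cvg_cst].
- by rewrite ge_max e0 sub0r oppr_le0.
- by rewrite subrr le_max lexx orbT.
Qed.

Lemma cutoff_eq0 (b : R) (e : R -> R -> R) (s t : R) :
  s < b -> cutoff b e s t = 0 -> e s t = 0.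
Proof.
move=> sb; rewrite /cutoff; case: leP => // h sb0.
by move: sb; rewrite -subr_lt0 sb0 ltxx.
Qed.

(* [cutoff b Num.min] encodes the complementarity problem on the box. *)
Lemma zero_near_box_NCP (b : R) (U : set 'rV[R]_n) : open U ->
  (forall x, is_zero F (fun=> cutoff b Num.min) x -> U x) ->
  exists2 c : R, 0 < c & forall e : 'I_n -> R -> R -> R,
    (forall i s t, 0 <= s <= b ->
       (c < s -> c < t -> 0 < e i s t) /\ (t < - c -> e i s t < 0)) ->
    forall x, box b x -> is_zero F (fun i => cutoff b (e i)) x -> U x.
Proof.
move=> oU ZU.
(* The two ways in which box complementarity fails, with margin [c]; in each of them the signs of
   [e] make its cutoff nonzero. *)
pose sep (c : R) (x : 'rV[R]_n) i := (c < x ord0 i /\ c < F x ord0 i) \/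
  (F x ord0 i < - c /\ x ord0 i < b).
have [c c0 cP] : exists2 c : R, 0 < c &
    box b `<=` (fun x => U x \/ exists i, sep c x i).
  have /compact_near_coveringP/(_ R 0^'+
    (fun c x => U x \/ exists i, sep c x i) _) cov := @compact_box R n b.
  suff H : \forall c \near (0 : R)^'+,
      box b `<=` (fun x => U x \/ exists i, sep c x i).
    have H0 := nbhs_right_gt (0 : R).
    have [c [c0 cP]] := filter_ex (filterI H0 H).
    by exists c.
  apply: cov => x xb; have [Ux|nUx] := pselect (U x).
    exists (U, setT) => /=; first by split;
      [exact: open_nbhs_nbhs|exact: filterT].
    by move=> [y c] [/= Uy _]; left.
  have [i xi] : exists i, cutoff b Num.min (x ord0 i) (F x ord0 i) != 0.
    apply: contrapT => h; apply: nUx; apply: ZU => i.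
    by apply/eqP/negPn/negP => hi; apply: h; exists i.
  (* Halving the margin found at [x] leaves strict inequalities, which persist near [x]. *)
  have [m m0 mP] : exists2 m : R, 0 < m & sep m x i.
    have /andP[x0 xlb] := xb i; move: xi; rewrite /cutoff neq_lt /sep.
    rewrite gt_max gt_min lt_max lt_min subr_lt0 subr_gt0 => /orP[|].
      rewrite ltNge x0 /= => /andP[Fx xb'].
      exists (- F x ord0 i / 2); first lra.
      by right; split => //; lra.
    rewrite (ltNge b) xlb orbF => /andP[x0' F0].
    have min0 : 0 < Num.min (x ord0 i) (F x ord0 i) by rewrite lt_min x0' F0.
    have minx : Num.min (x ord0 i) (F x ord0 i) <= x ord0 i.
      by rewrite ge_min lexx.
    have minF : Num.min (x ord0 i) (F x ord0 i) <= F x ord0 i.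
      by rewrite ge_min lexx orbT.
    by exists (Num.min (x ord0 i) (F x ord0 i) / 2); [|left; split]; lra.
  have xc : (y : 'rV[R]_n) ord0 i @[y --> x] --> x ord0 i.
    exact: coord_continuous.
  have Fc : (F y ord0 i) @[y --> x] --> F x ord0 i by exact: Fcoord_cont.
  have near_m : \forall y \near x, sep m y i.
    case: mP => -[h1 h2].
      near=> y; left; split; near: y; [exact: cvgr_gt h1|exact: cvgr_gt h2].
    near=> y; right; split; near: y; [exact: cvgr_lt h1|exact: cvgr_lt h2].
  exists ((fun y => sep m y i), [set c : R | c < m]) => /=.
    by split => //; exact: nbhs_right_lt.
  move=> [y c] [/= ym cm]; right; exists i.
  by case: ym => -[h1 h2]; [left|right]; split => //; lra.
exists c => // e eP x xb xz; have [//|[i [[cx cF]|[Fc xlb]]]] := cP x xb.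
  have [/(_ cx cF) h _] := eP i (x ord0 i) (F x ord0 i) (xb i).
  by have := xz i; rewrite /cutoff => /eqP; rewrite gt_eqF // lt_max h.
have [_ /(_ Fc) h] := eP i (x ord0 i) (F x ord0 i) (xb i).
by have := xz i; rewrite /cutoff => /eqP; rewrite lt_eqF // gt_max h subr_lt0.
Unshelve. all: by end_near. Qed.

End box_complementarity.

(** * Tikhonov regularization with a moving centre *)

Section tikhonov_path.
Variables (R : realType) (n : nat) (F : 'rV[R]_n -> 'rV[R]_n).
Hypothesis F_cont : continuous F.
Hypothesis F_P0 : P0_function F.

(** The min-equation of complementarity for [F x + eps * (x - z)]; strictness in [s] comes from
    [eps > 0]. *)
Definition tikhonov (eps z s t : R) : R := Num.min s (t + eps * (s - z)).

Lemma tikhonov_continuous (eps : R) :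
  continuous (fun u : R * (R * R) => tikhonov eps u.1 u.2.1 u.2.2).
Proof.
have c1 : continuous (fun u : R * (R * R) => u.2.1).
  by move=> u; apply: (@continuous_comp _ _ _ snd fst);
    [exact: cvg_snd|exact: cvg_fst].
have c2 : continuous (fun u : R * (R * R) => u.2.2).
  by move=> u; apply: (@continuous_comp _ _ _ snd snd); exact: cvg_snd.
move=> u; apply: (@continuous_minr R _ (fun u => u.2.1)
  (fun u => u.2.2 + eps * (u.2.1 - u.1))); first exact: c1.
apply: cvgD; first exact: c2.
apply: cvgM; first exact: cvg_cst.
by apply: cvgB; [exact: c1|exact: cvg_fst].
Qed.

Lemma barrier_tikhonov (b eps z : R) : 0 <= b -> 0 < eps ->
  barrier b (cutoff b (tikhonov eps z)).
Proof.
move=> b0 e0; apply: barrier_cutoff => // [s s' t t' ss' tt'|p|t].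
- rewrite /tikhonov lt_min !gt_min ss' /=; apply/orP; right.
  by rewrite ler_ltD // ltr_pM2l // ltrD2r.
- apply: (@continuous_comp _ _ _ (fun p : R * R => (z, p))
    (fun u : R * (R * R) => tikhonov eps u.1 u.2.1 u.2.2)).
    by apply: continuous_pair_for; [exact: cst_continuous|exact: cvg_id].
  exact: tikhonov_continuous.
- by rewrite /tikhonov ge_min lexx.
Qed.

Lemma NCP_minP (x : 'rV[R]_n) :
  NCP_solutions F x <-> forall i, Num.min (x ord0 i) (F x ord0 i) = 0.
Proof.
split=> [[x0 F0 /eqP]|xF].
  rewrite psumr_eq0; last by move=> i _; rewrite mulr_ge0.
  move=> /allP xF i; have := xF i (mem_index_enum _).
  rewrite /= mulf_eq0 => /orP[/eqP ->|/eqP ->]; [exact: min_l|exact: min_r].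
have xF0 i : [/\ 0 <= x ord0 i, 0 <= F x ord0 i & x ord0 i * F x ord0 i = 0].
  have := xF i; case: (leP (x ord0 i) (F x ord0 i)) => h h0.
    by rewrite -{2}h0 h h0 mul0r lexx.
  by rewrite -h0 ltW // h0 mulr0 lexx.
by split=> [i|i|]; [have [] := xF0 i|have [] := xF0 i|
  apply: big1 => i _; have [] := xF0 i].
Qed.

(* If [q] is another solution on the box, the zeros of the regularized problems
   centred at the points of the segment from [p] to [q] join [p] to [q] (which
   are zeros of the problems centred at themselves). They cross a sphere that
   lies between the solution set and the boundary of the box, and letting
   [eps] go to 0 would produce a solution on that sphere. *)
Lemma box_NCP_solution (b c : R) (p q : 'rV[R]_n) : 0 <= c -> c < b ->
  (forall z, NCP_solutions F z -> `|z| <= c) -> NCP_solutions F p ->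
  is_zero F (fun=> cutoff b Num.min) q -> NCP_solutions F q.
Proof.
move=> c0 cb Zc Zp zq.
have b0 : 0 <= b by lra.
have lt_sol x : `|x| < b -> is_zero F (fun=> cutoff b Num.min) x ->
    NCP_solutions F x.
  move=> xb xz; apply/NCP_minP => i; apply: cutoff_eq0 (xz i).
  by apply: le_lt_trans xb; apply: le_trans (coord_le_mxnorm x i);
    exact: ler_norm.
have [|qb] := ltP `|q| b; first by move=> /lt_sol; exact.
(* A box solution of norm [m < b] would lie in [NCP_solutions F], hence have norm at most
   [c < m]. *)
pose m := (b + c) / 2.
have oU : open [set x : 'rV[R]_n | `|x| != m].
  apply: (@open_comp _ _ (fun x : 'rV[R]_n => `|x|) [set y | y != m]) => [x _|].
    exact: norm_continuous.
  exact: open_neq.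
have [x xz /=|c1 c10 c1P] := @zero_near_box_NCP R n F F_cont b _ oU.
  apply/negP => /eqP xm.
  have /Zc : NCP_solutions F x by apply: lt_sol xz; rewrite xm /m; lra.
  by rewrite xm /m; lra.
(* The regularizing term must stay below the tolerance [c1] on the box; the [+ 1] makes
   [eps * b < c1] strict. *)
pose eps := c1 / (b + 1).
have eps0 : 0 < eps by rewrite divr_gt0 //; lra.
have epsb : eps * b < c1.
  by rewrite /eps mulrAC ltr_pdivrMr; nra.
pose z (t : R) (i : 'I_n) := p ord0 i + t * (q ord0 i - p ord0 i).
pose E t i := cutoff b (tikhonov eps (z t i)).
have Eb t i : barrier b (E t i) by exact: barrier_tikhonov.
have /choice[x xz] : forall t, exists x, is_zero F (E t) x.
  by move=> t; exact: (@exists_zero R n F F_cont F_P0 b).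
have xuniq t y : is_zero F (E t) y -> y = x t.
  move=> yz; apply: zero_unique yz (xz t) => // i.
  by have [] := Eb t i.
have xc : continuous x.
  move=> t; apply: (@zero_continuous R n F F_cont _ E b).
  - by near=> s; split; [exact: zero_in_box (Eb s) (xz s)|exact: xz].
  - move=> i u.
    apply: (@continuous_maxr R _
      (fun u : R * (R * R) => tikhonov eps (z u.1 i) u.2.1 u.2.2)
      (fun u => u.2.1 - b)).
      apply: (@continuous_comp _ _ _ (fun u : R * (R * R) => (z u.1 i, u.2))
        (fun u => tikhonov eps u.1 u.2.1 u.2.2)).
        apply: continuous_pair_for; last exact: cvg_snd.
        apply: cvgD; first exact: cvg_cst.
        by apply: cvgM; [exact: cvg_fst|exact: cvg_cst].
      exact: tikhonov_continuous.
    apply: cvgB; last exact: cvg_cst.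
    by apply: (@continuous_comp _ _ _ snd fst); [exact: cvg_snd|exact: cvg_fst].
  - exact: xuniq.
have tikhonovss s t : tikhonov eps s s t = Num.min s t.
  by rewrite /tikhonov subrr mulr0 addr0.
have zp : is_zero F (fun=> cutoff b Num.min) p.
  move=> i; have /NCP_minP/(_ i) := Zp; rewrite /cutoff => ->.
  apply: max_l; rewrite subr_le0 (le_trans (ler_norm _)) //.
  by rewrite (le_trans (coord_le_mxnorm p i)) // (le_trans (Zc _ Zp)) // ltW.
have xp : x 0 = p.
  apply/esym/xuniq => i; have := zp i.
  by rewrite /E /z mul0r addr0 /cutoff tikhonovss.
have xq : x 1 = q.
  apply/esym/xuniq => i; have := zq i.
  by rewrite /E /z mul1r addrC subrK /cutoff tikhonovss.
have pb : box b p by rewrite -xp; exact: zero_in_box (Eb 0) (xz 0).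
have qbox : box b q by rewrite -xq; exact: zero_in_box (Eb 1) (xz 1).
have [||||t /andP[t0 t1] xtm] := @IVT_le R (fun t => `|x t|) 0 1 m.
- lra.
- move=> t; apply: (@continuous_comp _ _ _ x (fun y : 'rV[R]_n => `|y|)).
    exact: xc.
  exact: norm_continuous.
- by rewrite xp (le_trans (Zc _ Zp)) // /m; lra.
- by rewrite xq (le_trans _ qb) // /m; lra.
have /negP[] : `|x t| != m; last exact/eqP.
apply: (c1P (fun i => tikhonov eps (z t i))).
- move=> i s u /andP[s0 sb].
  (* The centre stays in the box by convexity, so [s - z t i] lies between [- b] and [b]. *)
  have [zi0 zib] : 0 <= z t i /\ z t i <= b.
    have /andP[? ?] := pb i; have /andP[? ?] := qbox i.
    by rewrite /z; split; nra.
  have lo : eps * - b <= eps * (s - z t i) by rewrite ler_pM2l //; lra.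
  have hi : eps * (s - z t i) <= eps * b by rewrite ler_pM2l //; lra.
  rewrite /tikhonov; split => [cs cu|uc].
    by rewrite lt_min; apply/andP; split; lra.
  by rewrite gt_min; apply/orP; right; lra.
- exact: zero_in_box (Eb t) (xz t).
- exact: xz.
Unshelve. all: by end_near. Qed.

End tikhonov_path.

(** * The smoothed system *)

Section smoothing.
Variables (R : realType) (theta : R -> R).
Hypothesis theta_lt1 : forall t, theta t < 1.
Hypothesis theta_C2 : C2 theta.
Hypothesis theta0 : theta 0 = 0.
Hypothesis theta_lim : theta t @[t --> +oo] --> (1 : R).
Hypothesis theta'_gt0 : forall t, 0 < theta^`()%classic t.
Hypothesis theta''_le0 : forall t, theta^`()^`()%classic t <= 0.

Lemma theta_continuous : continuous theta.
Proof. by have [d _ _] := theta_C2; exact: derivable_continuous. Qed.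

Lemma theta_le_mono : {mono theta : s t / s <= t}.
Proof.
have [d _ _] := theta_C2.
apply: le_mono => s t st.
apply: (@gtr0_derive1_lt_cc R theta s t) => //.
- exact/continuous_subspaceT/theta_continuous.
- by rewrite in_itv /= lexx ltW.
- by rewrite in_itv /= lexx ltW.
Qed.

Lemma theta_mono : {mono theta : s t / s < t}.
Proof. exact/leW_mono/theta_le_mono. Qed.

(** Concavity: left of 0 the slope is at least the slope at 0. Hence [theta] is unbounded below. *)
Lemma theta_le_tangent (t : R) : t <= 0 -> theta t <= theta^`()%classic 0 * t.
Proof.
have [d d2 _] := theta_C2; move=> t0.
have [|c] := @MVT_segment R theta (theta^`()%classic) t 0 t0 _
  (continuous_subspaceT theta_continuous).
  by move=> s _; rewrite derive1E; exact/derivableP.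
rewrite in_itv /= => /andP[tc c0]; rewrite theta0 => thc.
have : theta^`()%classic 0 <= theta^`()%classic c.
  apply: (@ler0_derive1_le_cc R _ c 0) => //.
  - exact/continuous_subspaceT/derivable_continuous.
  - by rewrite in_itv /= lexx c0.
  - by rewrite in_itv /= lexx c0.
nra.
Qed.

Lemma psi_surj (a : R) : 0 < a -> exists t, psi theta t = a.
Proof.
move=> a0.
have [t1 t1a] : exists t, 1 - a < theta t.
  have : \forall t \near +oo, 1 - a < theta t by apply: (cvgr_gt 1) => //; lra.
  by move=> /filter_ex.
pose k := theta^`()%classic 0.
have k0 : 0 < k by exact: theta'_gt0.
(* [t0 <= t1] orders the interval, [t0 <= 0] allows the tangent bound, and the third term brings
   that bound down to [1 - a]. *)
pose t0 := Num.min t1 (Num.min 0 ((1 - a) / k)).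
have t0t1 : t0 <= t1 by rewrite /t0 ge_min lexx.
have t00 : t0 <= 0 by rewrite /t0 !ge_min lexx !orbT.
have t0k : t0 <= (1 - a) / k by rewrite /t0 !ge_min lexx !orbT.
have [||t _ tE] := @IVT_le R theta t0 t1 (1 - a) t0t1 theta_continuous.
- rewrite (le_trans (theta_le_tangent t00)) // -/k mulrC -ler_pdivlMr //.
- exact: ltW.
by exists t; rewrite /psi tE; lra.
Qed.

(** Surjectivity of [psi theta] onto the positive reals rules out the default value of [psi_inv];
    the rest is [psi theta 0 = 1] and injectivity. *)
Lemma psi_inv_eq0 (a : R) : 0 < a -> psi_inv theta a = 0 <-> a = 1.
Proof.
move=> a0; have [t ta] := psi_surj a0.
have psiK : psi theta (psi_inv theta a) = a.
  by apply: pinvK; rewrite inE /=; exists t.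
split=> [h|a1]; first by rewrite -psiK h /psi theta0 subr0.
have : theta (psi_inv theta a) = theta 0.
  by rewrite theta0; move: psiK; rewrite /psi a1; lra.
by case: (ltgtP (psi_inv theta a) 0) => // h;
  have := h; rewrite -theta_mono => /[swap] ->; rewrite ltxx.
Qed.

(** This is 1 minus the argument of [psi_inv] in [G], so for [r > 0] it vanishes exactly when [G]
    does. *)
Definition smooth (r s t : R) : R := theta (s / r) + theta (t / r) - 1.

Lemma H_eq0 (n : nat) (F : 'rV[R]_n -> 'rV[R]_n) (r : R) (x : 'rV[R]_n) :
  0 < r -> H theta F r x = 0 <->
  is_zero F (fun=> smooth r) x.
Proof.
move=> r0.
have GE s t : G theta r s t = 0 <-> smooth r s t = 0.
  rewrite /G /psi; set a := _ + _.
  have a0 : 0 < a.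
    by rewrite /a; have := theta_lt1 (s / r); have := theta_lt1 (t / r); lra.
  have aE : smooth r s t = 1 - a by rewrite /smooth /a; lra.
  rewrite aE; split=> [/eqP|a1].
    rewrite mulf_eq0 gt_eqF //= => /eqP /(psi_inv_eq0 a0) ->; exact: subrr.
  by rewrite (psi_inv_eq0 a0).2 ?mulr0 //; lra.
split=> [H0 i|xz]; first by apply/GE; have /rowP/(_ i) := H0; rewrite !mxE.
by apply/rowP => i; rewrite !mxE; apply/GE; exact: xz.
Qed.

Lemma smooth_continuous (r : R) (p : R * R) : 0 < r ->
  {for (r, p), continuous (fun u : R * (R * R) => smooth u.1 u.2.1 u.2.2)}.
Proof.
move=> r0.
have c1 : {for (r, p), continuous (fun u : R * (R * R) => u.2.1 / u.1)}.
  apply: cvgM.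
    by apply: (@continuous_comp _ _ _ snd fst); [exact: cvg_snd|exact: cvg_fst].
  by apply: cvgV; [rewrite gt_eqF|exact: cvg_fst].
have c2 : {for (r, p), continuous (fun u : R * (R * R) => u.2.2 / u.1)}.
  apply: cvgM; first by apply: (@continuous_comp _ _ _ snd snd); exact: cvg_snd.
  by apply: cvgV; [rewrite gt_eqF|exact: cvg_fst].
apply: cvgB; last exact: cvg_cst.
apply: cvgD.
  exact: (continuous_comp c1 (@theta_continuous _)).
exact: (continuous_comp c2 (@theta_continuous _)).
Qed.

Lemma smooth_strict_mono (r : R) : 0 < r -> strict_mono (smooth r).
Proof.
move=> r0 s s' t t' ss' tt'; rewrite /smooth ltrD2r ltr_leD //.
  by rewrite theta_mono ltr_pM2r // invr_gt0.
by rewrite theta_le_mono ler_pM2r // invr_gt0.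
Qed.

Lemma barrier_smooth (b r : R) : 0 <= b -> 0 < r ->
  barrier b (cutoff b (smooth r)).
Proof.
move=> b0 r0; apply: barrier_cutoff => // [|p|t].
- exact: smooth_strict_mono.
- apply: (@continuous_comp _ _ _ (fun p : R * R => (r, p))
    (fun u : R * (R * R) => smooth u.1 u.2.1 u.2.2)).
    by apply: continuous_pair_for; [exact: cst_continuous|exact: cvg_id].
  exact: smooth_continuous.
- by rewrite /smooth mul0r theta0 add0r subr_le0 ltW.
Qed.

(** Two arguments beyond [M] give values of [theta] above 1/2, with sum above 1; a negative [t]
    gives a negative term, while the other stays below 1. Division by [r] shrinks the threshold to
    [r * M]. *)
Lemma smooth_sign : exists2 M : R, 0 < M & forall c r s t : R,
  0 < r -> r * M < c ->
  (c < s -> c < t -> 0 < smooth r s t) /\ (t < - c -> smooth r s t < 0).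
Proof.
have : \forall t \near +oo, 1 / 2 < theta t by apply: (cvgr_gt 1) => //; lra.
move=> [M [_ MP]]; pose M' := Num.max M 1.
have M'M : M <= M' by rewrite /M' le_max lexx.
have M'1 : 1 <= M' by rewrite /M' le_max lexx orbT.
exists M' => [|c r s t r0 rc]; first lra.
have big u : c < u -> 1 / 2 < theta (u / r).
  by move=> cu; apply: MP; rewrite ltr_pdivlMr //; nra.
split=> [/big cs /big ct|tc]; rewrite /smooth; first lra.
have : theta (t / r) < 0.
  by rewrite -theta0 theta_mono pmulr_llt0 ?invr_gt0 //; nra.
by have := theta_lt1 (s / r); lra.
Qed.

End smoothing.

(** * The trajectory of solutions and its limit as [r] tends to 0 *)

Theorem theorem3p1 (R : realType) (n : nat) (theta : R -> R)
    (theta_lt1 : forall t, theta t < 1)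
    (theta_C2 : C2 theta)
    (theta0 : theta 0 = 0)
    (theta_lim : theta t @[t --> +oo] --> (1 : R))
    (theta'_gt0 : forall t, 0 < theta^`()%classic t)
    (theta''_le0 : forall t, theta^`()^`()%classic t <= 0)
    (V_subadd : locally_subadditive_at0 (V theta))
    (F : 'rV[R]_n -> 'rV[R]_n)
    (F_cont : continuous F)
    (F_P0 : P0_function F)
    (Z_nonempty : NCP_solutions F !=set0)
    (Z_compact : compact (NCP_solutions F)) :
  exists2 rhat : R, 0 < rhat &
  exists xr : R -> 'rV[R]_n,
    [/\ forall r, 0 < r -> r < rhat ->
          H theta F r (xr r) = 0 /\
          (forall y, H theta F r y = 0 -> y = xr r),
        {within [set r | 0 < r < rhat], continuous xr} &
        eucl_dist (xr r) (NCP_solutions F) @[r --> 0^'+] --> (0 : R)].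
Proof.
have [p Zp] := Z_nonempty.
have [c c0 Zc] : exists2 c : R, 0 <= c &
    forall z, NCP_solutions F z -> `|z| <= c.
  have [M [_ MP]] := compact_bounded Z_compact.
  (* Boundedness only yields bounds strictly above [M], whence the [+ 1]; the maximum makes the
     bound nonnegative. *)
  have MM : M < Num.max M 0 + 1.
    by rewrite (@le_lt_trans _ _ (Num.max M 0)) ?le_max ?lexx // ltrDl.
  exists (Num.max M 0 + 1); first by rewrite addr_ge0 // le_max lexx orbT.
  exact: MP MM.
pose b := c + 1.
have cb : c < b by rewrite /b; lra.
have b0 : 0 <= b by lra.
have box_Z x : is_zero F (fun=> cutoff b Num.min) x -> NCP_solutions F x.
  exact: box_NCP_solution c0 cb Zc Zp.
have [M M0 MP] := smooth_sign theta_lt1 theta_C2 theta0 theta_lim theta'_gt0.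
have sb r : 0 < r -> barrier b (cutoff b (smooth theta r)).
  exact: barrier_smooth.
(* For [r <= 0] the value of [xr] is arbitrary. *)
have /choice[xr xrz] : forall r, exists x, 0 < r ->
    is_zero F (fun=> cutoff b (smooth theta r)) x.
  move=> r; have [r0|r0] := ltP 0 r; last by exists 0.
  have [x xz] := exists_zero F_cont F_P0 b0 (fun=> sb r r0).
  by exists x.
(* Used twice: with the open ball of radius [b] to obtain [rhat], and with Euclidean neighbourhoods
   of the solution set for the limit. *)
have xr_near U : open U -> NCP_solutions F `<=` U ->
    exists2 d : R, 0 < d & forall r, 0 < r -> r < d -> U (xr r).
  move=> oU ZU; have [x /box_Z/ZU//|d d0 dP] :=
    zero_near_box_NCP F_cont oU (b := b).
  exists (d / M); first exact: divr_gt0.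
  move=> r r0; rewrite ltr_pdivlMr // => rd.
  apply: (dP (fun=> smooth theta r)).
  - by move=> i s t _; exact: MP.
  - exact: zero_in_box (fun=> sb r r0) (xrz r r0).
  - exact: xrz.
have oB : open [set x : 'rV[R]_n | `|x| < b].
  apply: (@open_comp _ _ (fun x : 'rV[R]_n => `|x|) [set y | y < b]) => [x _|].
    exact: norm_continuous.
  exact: open_lt.
have [|rhat rhat0 rhatP] := xr_near _ oB.
  by move=> z /Zc zc /=; exact: le_lt_trans cb.
exists rhat => //; exists xr; split.
- move=> r r0 rr.
  (* Below [rhat] the solution has norm less than [b], so the cutoff is inactive. *)
  have xz : is_zero F (fun=> smooth theta r) (xr r).
    move=> i; apply: cutoff_eq0 (xrz r r0 i).
    apply: le_lt_trans (rhatP r r0 rr).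
    exact: le_trans (ler_norm _) (coord_le_mxnorm _ i).
  have HE y := H_eq0 theta_lt1 theta_C2 theta0 theta_lim theta'_gt0 theta''_le0
    F y r0.
  split=> [|y /HE yz]; first exact/HE.
  (* Uniqueness holds in the whole space, since [smooth theta r] is strictly monotone without the
     cutoff. *)
  by apply: zero_unique yz xz => // i; exact: smooth_strict_mono.
- apply: continuous_in_subspaceT => r; rewrite inE => /andP[r0 _].
  apply: (@zero_continuous R n F F_cont _
    (fun r _ => cutoff b (smooth theta r)) b).
  + near=> s; have s0 : 0 < s by near: s; exact: lt_nbhsr.
    by split; [exact: zero_in_box (fun=> sb s s0) (xrz s s0)|exact: xrz].
  + move=> i u; apply: (@continuous_maxr R _
      (fun u : R * (R * R) => smooth theta u.1 u.2.1 u.2.2)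
      (fun u => u.2.1 - b)).
      exact: smooth_continuous.
    apply: cvgB; last exact: cvg_cst.
    by apply: (@continuous_comp _ _ _ snd fst); [exact: cvg_snd|exact: cvg_fst].
  + move=> y yz; apply: zero_unique yz (xrz r r0) => // i.
    by have [] := sb r r0.
- apply/cvgrPdist_lt => d d0.
  have [|e e0 eP] := xr_near _ (@open_eucl_nbhd R n (NCP_solutions F) d).
    by move=> z Zz; exists z => //; rewrite subrr eucl_norm0.
  near=> r.
  have r0 : 0 < r by near: r; exact: nbhs_right_gt.
  have re : r < e by near: r; exact: nbhs_right_lt.
  have [z Zz xz] := eP r r0 re.
  have /andP[h0 hd] := eucl_dist_lt Zz xz.
  by rewrite sub0r normrN ger0_norm.
Unshelve. all: by end_near. Qed.
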